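(* Let $h\geq 2$, let $(M_1,\Delta_1),\ldots,(M_h,\Delta_h)$ be homogeneous Garside monoids, all distinct from $M(1,1)$, and let $M=M_1*_\Delta\cdots*_\Delta M_h$ be their $\Delta$-product. The intersection in $G(M)$ of all the subgroups $\varphi_i(G(M_i))$ for $i\in\{1,\ldots,h\}$ is the subgroup generated by $\Delta$. The center of $G(M)$ is cyclic and generated by the smallest central power of $\Delta$ in $G(M)$, i.e. by $\Delta^k$ where $k$ is the least positive integer such that $\Delta^k$ is central in $G(M)$.
   Context: A monoid $M$ is homogeneous if there is a monoid morphism $M\to(\mathbb{Z}_{\geq 0},+)$ such that the elements of positive image generate $M$. Let $M$ be homogeneous and cancellative. Write $a\preceq b$ if $b=ac$ for some $c\in M$ (left-divisibility) and $b\succeq a$ if $b=ca$ for some $c\in M$ (right-divisibility). $(M,\Delta)$ is a homogeneous Garside monoid if $(M,\preceq)$ and $(M,\succeq)$ are lattices and $\Delta\in M$ has equal sets of left- and right-divisors, this set being finite and generating $M$. $M$ embeds in its enveloping group $G(M)$, and some positive power of $\Delta$ is central in $G(M)$. The $\Delta$-product $M=M_1*_\Delta\cdots*_\Delta M_h$ is the quotient of the free product of monoids $M_1*\cdots*M_h$ by the relations $\Delta_i=\Delta_j$ for all $i,j$. Let $\Delta\in M$ be the common image of the $\Delta_i$. It is known that $(M,\Delta)$ is a homogeneous Garside monoid. The natural group morphism $G(M_i)\to G(M)$ is denoted by $\varphi_i$. $M(1,1)$ denotes the monoid $\mathbb{Z}_{\geq 0}$ with Garside element its generator; ''distinct from $M(1,1)$''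 means that $(M_i,\Delta_i)$ is not isomorphic to it as a monoid with distinguished Garside element.
   Formalization: Added assumption: if one Δ_i is 1 (M_i trivial) then all are. Otherwise the claim fails: M_1 trivial and M_2 = ⟨a,b | aba=bab⟩ with Δ_2 = aba give G(M) = Z/3 with Δ = 1, and M is not a homogeneous Garside monoid. *)

(* Defs.v *)
From HB Require Import structures.
From mathcomp Require Import all_boot.
From mathcomp Require Import boolp classical_sets cardinality.

Set Implicit Arguments.
Unset Strict Implicit.
Unset Printing Implicit Defensive.

Local Open Scope classical_set_scope.
Local Open Scope quotient_scope.
Local Open Scope group_scope.

(* Bundled monoid morphisms; between groups these are the group morphisms. *)
Notation "{ 'monoid_hom' M -> N }" := (UMagmaMorphism.type M N)
  (at level 0, M at level 98, N at level 99,
   format "{ 'monoid_hom'  M  ->  N }").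

Section Generation.
Context (M : monoidType) (G : groupType).

Definition is_submonoid (S : set M) : Prop :=
  S 1 /\ forall x y, S x -> S y -> S (x * y).

Definition is_subgroup (S : set G) : Prop :=
  [/\ S 1, forall x y, S x -> S y -> S (x * y) & forall x, S x -> S x^-1].

Definition gen_submonoid (A : set M) : set M := smallest is_submonoid A.
Definition gen_subgroup (A : set G) : set G := smallest is_subgroup A.

Definition center : set G := [set x | forall y, commute x y].

End Generation.

Arguments center : clear implicits.

(* The additive monoid of natural numbers: here [1 = 0%N] and [x * y = x + y]. *)
Definition addnat : Type := nat.
HB.instance Definition _ := Choice.copy addnat nat.
HB.instance Definition _ := isMonoid.Build addnat addnA add0n addn0.

Section Garside.
Context (M : monoidType).

Definition homogeneous : Prop := exists len : {monoid_hom M -> addnat},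
  gen_submonoid [set x | (0 < (len x : nat))%N] = [set: M].

Definition cancellative : Prop := forall a x y : M,
  (a * x = a * y -> x = y) /\ (x * a = y * a -> x = y).

Definition ldiv (a b : M) : Prop := exists c, b = a * c.
Definition rdiv (a b : M) : Prop := exists c, b = c * a.

Definition is_glb (le : M -> M -> Prop) (a b m : M) : Prop :=
  [/\ le m a, le m b & forall c, le c a -> le c b -> le c m].

Definition is_lattice (le : M -> M -> Prop) : Prop :=
  [/\ forall a, le a a,
      forall a b c, le a b -> le b c -> le a c,
      forall a b, le a b -> le b a -> a = b,
      forall a b, exists m, is_glb le a b m
    & forall a b, exists j, is_glb (fun x y => le y x) a b j].

(* The trivial monoid, with [Delta = 1], is a homogeneous Garside monoid in     *)
(* this sense.                                                                  *)
Definition homogeneous_garside (Delta : M) : Prop :=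
  (homogeneous /\ cancellative) /\
  [/\ is_lattice ldiv,
      is_lattice rdiv,
      [set a | ldiv a Delta] = [set a | rdiv a Delta],
      finite_set [set a | ldiv a Delta]
    & gen_submonoid [set a | ldiv a Delta] = [set: M]].

End Garside.

Definition pointed_isom (M N : monoidType) (a : M) (b : N) : Prop :=
  exists2 f : {monoid_hom M -> N}, bijective f & f a = b.

(* [M(1,1)] is the additive monoid of naturals with Garside element [1%N].      *)
Definition is_M11 (M : monoidType) (Delta : M) : Prop :=
  pointed_isom Delta (1%N : addnat).

Section MonoidQuotient.
Context (N : monoidType) (R : N -> N -> Prop).

Inductive cong : N -> N -> Prop :=
| cong_rel x y of R x y : cong x y
| cong_refl x : cong x x
| cong_sym x y of cong x y : cong y x
| cong_trans y x z of cong x y & cong y z : cong x z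
| cong_mul x x' y y' of cong x x' & cong y y' : cong (x * y) (x' * y').

Definition congb (x y : N) : bool := `[< cong x y >].

Lemma congb_refl : reflexive congb.
Proof. by move=> x; apply/asboolP; apply: cong_refl. Qed.
Lemma congb_sym : symmetric congb.
Proof. by move=> x y; apply/asboolP/asboolP => /cong_sym. Qed.
Lemma congb_trans : transitive congb.
Proof.
by move=> y x z /asboolP xy /asboolP yz; apply/asboolP; apply: cong_trans yz.
Qed.

Canonical congb_equiv := EquivRel congb congb_refl congb_sym congb_trans.

Definition mquo : Type := {eq_quot congb}.
HB.instance Definition _ := Choice.on mquo.
HB.instance Definition _ := Quotient.on mquo.

Definition mquo_pi (x : N) : mquo := \pi_mquo x.

Lemma mquo_piE x y : mquo_pi x = mquo_pi y <-> cong x y.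
Proof.
split=> [/eqmodP/asboolP // | xy].
by apply/eqmodP; apply/asboolP.
Qed.

Lemma mquo_repr_pi x : cong (repr (mquo_pi x)) x.
Proof. by apply/mquo_piE; rewrite /mquo_pi reprK. Qed.

Definition mquo_mul (p q : mquo) : mquo := mquo_pi (repr p * repr q).

Lemma mquo_mulE x y : mquo_mul (mquo_pi x) (mquo_pi y) = mquo_pi (x * y).
Proof. by apply/mquo_piE; apply: cong_mul; apply: mquo_repr_pi. Qed.

Lemma mquo_ind (P : mquo -> Prop) : (forall x, P (mquo_pi x)) -> forall q, P q.
Proof. by move=> H q; rewrite -[q]reprK; apply: H. Qed.

Lemma mquo_mulA : associative mquo_mul.
Proof.
elim/mquo_ind=> x; elim/mquo_ind=> y; elim/mquo_ind=> z.
by rewrite !mquo_mulE mulgA.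
Qed.
Lemma mquo_mul1 : left_id (mquo_pi 1) mquo_mul.
Proof. by elim/mquo_ind=> x; rewrite mquo_mulE mul1g. Qed.
Lemma mquo_mulr1 : right_id (mquo_pi 1) mquo_mul.
Proof. by elim/mquo_ind=> x; rewrite mquo_mulE mulg1. Qed.

HB.instance Definition _ :=
  isMonoid.Build mquo mquo_mulA mquo_mul1 mquo_mulr1.

Lemma mquo_pi_monoid_morphism :
  mquo_pi 1 = 1 /\ {morph mquo_pi : x y / x * y}.
Proof. by split=> // x y; rewrite [RHS]mquo_mulE. Qed.

HB.instance Definition _ :=
  isUMagmaMorphism.Build N mquo mquo_pi mquo_pi_monoid_morphism.

Definition mquo_lift (P : monoidType) (f : N -> P) (q : mquo) : P :=
  f (repr q).

Lemma mquo_liftE (P : monoidType) (f : {monoid_hom N -> P}) :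
  (forall x y, R x y -> f x = f y) ->
  forall x, mquo_lift f (mquo_pi x) = f x.
Proof.
move=> fR x; rewrite /mquo_lift.
have fcong y z : cong y z -> f y = f z.
  elim=> // [{}y {}x {}z _ -> _ -> // | a a' b b' _ aa' _ bb'].
  by rewrite !gmulfM aa' bb'.
exact/fcong/mquo_repr_pi.
Qed.

End MonoidQuotient.

Definition free_monoid (X : Type) : Type := seq X.
HB.instance Definition _ (X : choiceType) :=
  Choice.copy (free_monoid X) (seq X).
HB.instance Definition _ (X : choiceType) :=
  isMonoid.Build (free_monoid X) (@catA X) (@cat0s X) (@cats0 X).

Definition free_map (X Y : Type) (f : X -> Y) :
  free_monoid X -> free_monoid Y := map f.

Lemma free_map_monoid_morphism (X Y : choiceType) (f : X -> Y) :
  free_map f 1 = 1 /\ {morph free_map f : u v / u * v}.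
Proof. by split=> // u v; apply: map_cat. Qed.

HB.instance Definition _ (X Y : choiceType) (f : X -> Y) :=
  isUMagmaMorphism.Build (free_monoid X) (free_monoid Y) (free_map f)
    (free_map_monoid_morphism f).

(* The enveloping group, by generators [(a, false)] (the image of [a]) and     *)
(* [(a, true)] (its inverse), for [a] in [M].                                  *)
Section EnvelopingGroup.
Context (M : monoidType).

Local Notation words := (free_monoid (M * bool)%type).

Inductive env_rel : words -> words -> Prop :=
| env_rel1 : env_rel [:: (1, false)] [::]
| env_relM a b : env_rel [:: (a, false); (b, false)] [:: (a * b, false)]
| env_relV a : env_rel [:: (a, false); (a, true)] [::]
| env_relVl a : env_rel [:: (a, true); (a, false)] [::].

Definition env_group : Type := mquo env_rel.
HB.instance Definition _ := monoid.Monoid.on env_group.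

Definition env_pi : words -> env_group := @mquo_pi words env_rel.

Definition word_inv (w : words) : words :=
  rev [seq (x.1, ~~ x.2) | x <- w].

Lemma word_inv_mul u v : word_inv (u * v) = word_inv v * word_inv u.
Proof. by rewrite /word_inv map_cat rev_cat. Qed.

Lemma word_invK : involutive word_inv.
Proof.
move=> w; rewrite /word_inv map_rev revK -map_comp.
by apply: map_id_in => -[a b] _ /=; rewrite negbK.
Qed.

Lemma cong_word_mulV w : cong env_rel (w * word_inv w) 1.
Proof.
elim: w => [|x w IHw]; first exact: cong_refl.
have -> : x :: w = ([:: x] : words) * w by [].
rewrite word_inv_mul mulgA -[([:: x] : words) * w * word_inv w]mulgA.
apply: (@cong_trans _ _ (([:: x] : words) * 1 * word_inv [:: x])).
  by apply: cong_mul (cong_refl _ _); apply: cong_mul IHw; apply: cong_refl.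
rewrite mulg1; case: x => a [].
- by apply: cong_rel; apply: env_relVl.
- by apply: cong_rel; apply: env_relV.
Qed.

Lemma cong_word_mulVl w : cong env_rel (word_inv w * w) 1.
Proof. by rewrite -{2}[w]word_invK; apply: cong_word_mulV. Qed.

Definition env_inv (g : env_group) : env_group := env_pi (word_inv (repr g)).

HB.instance Definition _ := hasInv.Build env_group env_inv.

Lemma env_mulVg : left_inverse 1 env_inv (@mul env_group).
Proof.
move=> g; rewrite /env_inv -[X in _ * X]reprK.
rewrite [LHS](mquo_mulE env_rel (word_inv (repr g)) (repr g)).
by apply/mquo_piE; apply: cong_word_mulVl.
Qed.

Lemma env_mulgV : right_inverse 1 env_inv (@mul env_group).
Proof.
move=> g; rewrite /env_inv -[X in X * _]reprK.
rewrite [LHS](mquo_mulE env_rel (repr g) (word_inv (repr g))).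
by apply/mquo_piE; apply: cong_word_mulV.
Qed.

HB.instance Definition _ := Monoid_isGroup.Build env_group env_mulVg env_mulgV.

Definition env_in (a : M) : env_group := env_pi [:: (a, false)].

Lemma env_in_monoid_morphism :
  env_in 1 = 1 /\ {morph env_in : a b / a * b}.
Proof.
split=> [|a b]; first by apply/mquo_piE; apply: cong_rel; apply: env_rel1.
rewrite [RHS](mquo_mulE env_rel [:: (a, false)] [:: (b, false)]).
by apply/mquo_piE; apply: cong_sym; apply: cong_rel; apply: env_relM.
Qed.

HB.instance Definition _ :=
  isUMagmaMorphism.Build M env_group env_in env_in_monoid_morphism.

End EnvelopingGroup.

Section EnvelopingMap.
Context (M N : monoidType) (f : {monoid_hom M -> N}).

Definition env_map_words
    (w : free_monoid (M * bool)%type) : free_monoid (N * bool)%type :=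
  free_map (fun x => (f x.1, x.2)) w.

Definition env_map : env_group M -> env_group N :=
  @mquo_lift _ (@env_rel M) (env_group N) (fun w => env_pi (env_map_words w)).

Lemma env_map_pi w :
  env_map (env_pi w) = env_pi (env_map_words w).
Proof.
pose F := [the {monoid_hom _ -> _} of
  @mquo_pi _ (@env_rel N) \o free_map (fun x : M * bool => (f x.1, x.2))].
apply: (@mquo_liftE _ _ _ F) => x y xy; apply/mquo_piE; case: xy => [|a b|a|a].
- by rewrite /= gmulf1; apply: cong_rel; apply: env_rel1.
- by rewrite /= gmulfM; apply: cong_rel; apply: env_relM.
- by apply: cong_rel; apply: env_relV.
- by apply: cong_rel; apply: env_relVl.
Qed.

Lemma env_map_in a : env_map (env_in a) = env_in (f a).
Proof. exact: env_map_pi. Qed.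

Lemma env_map_monoid_morphism :
  env_map 1 = 1 /\ {morph env_map : x y / x * y}.
Proof.
split; first exact: (env_map_pi 1).
elim/mquo_ind=> u; elim/mquo_ind=> v.
rewrite [mquo_pi _ u * mquo_pi _ v]mquo_mulE !env_map_pi.
rewrite [RHS](mquo_mulE (@env_rel N)) /env_map_words.
by rewrite -gmulfM.
Qed.

HB.instance Definition _ :=
  isUMagmaMorphism.Build (env_group M) (env_group N) env_map
    env_map_monoid_morphism.

End EnvelopingMap.

Section FreeProduct.
Context (h : nat) (M : 'I_h -> monoidType).

Local Notation letter := {i : 'I_h & M i}.
Local Notation words := (free_monoid letter).

Inductive free_product_rel : words -> words -> Prop :=
| free_product_rel1 i : free_product_rel [:: Tagged M (1 : M i)] [::]
| free_product_relM i (a b : M i) :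
    free_product_rel [:: Tagged M a; Tagged M b] [:: Tagged M (a * b)].

Definition free_product : Type := mquo free_product_rel.
HB.instance Definition _ := monoid.Monoid.on free_product.

Definition free_product_in (i : 'I_h) (a : M i) : free_product :=
  mquo_pi free_product_rel [:: Tagged M a].

Lemma free_product_in_monoid_morphism i :
  @free_product_in i 1 = 1 /\ {morph @free_product_in i : a b / a * b}.
Proof.
split=> [|a b]; first by apply/mquo_piE; apply: cong_rel; constructor.
rewrite [RHS](mquo_mulE free_product_rel [:: Tagged M a] [:: Tagged M b]).
by apply/mquo_piE; apply: cong_sym; apply: cong_rel; constructor.
Qed.

HB.instance Definition _ i :=
  isUMagmaMorphism.Build (M i) free_product (@free_product_in i)
    (free_product_in_monoid_morphism i).

End FreeProduct.

Section DeltaProduct.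
Context (h : nat) (M : 'I_h -> monoidType) (Delta : forall i, M i).

Inductive delta_rel : free_product M -> free_product M -> Prop :=
| delta_rel_intro i j :
    delta_rel (free_product_in (Delta i)) (free_product_in (Delta j)).

Definition delta_product : Type := mquo delta_rel.
HB.instance Definition _ := monoid.Monoid.on delta_product.

Definition delta_in (i : 'I_h) : M i -> delta_product :=
  mquo_pi delta_rel \o @free_product_in h M i.
Arguments delta_in : clear implicits.

HB.instance Definition _ i :=
  UMagmaMorphism.copy (delta_in i)
    (mquo_pi delta_rel \o @free_product_in h M i).

Lemma delta_inE i j : delta_in i (Delta i) = delta_in j (Delta j).
Proof. by apply/mquo_piE; apply: cong_rel; constructor. Qed.

Definition delta_phi (i : 'I_h) : env_group (M i) -> env_group delta_product :=
  env_map (delta_in i).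
Arguments delta_phi : clear implicits.

HB.instance Definition _ i :=
  UMagmaMorphism.copy (delta_phi i) (env_map (delta_in i)).

End DeltaProduct.

Arguments delta_in {h M} Delta i _.
Arguments delta_phi {h M} Delta i _.

(* Main.v *)
From HB Require Import structures.
Require Import Defs.
From mathcomp Require Import all_boot ssralg ssrnum ssrint intdiv.
From mathcomp Require Import zify.
From mathcomp Require Import boolp classical_sets cardinality.

(** If some [Delta i] is trivial then all are, every [M i] is trivial by
    homogeneity, and so is [G(M)]. Assume from now on that no [Delta i] is
    trivial. The length then shows that [Delta i] has infinite order in
    [G(M_i)], and comparing universal properties shows that [G(M)] is the
    amalgamated product of the groups [G(M_i)] over the infinite cyclic group
    [C] generated by the [Delta i] ([env_delta_extend]). Both assertions are
    facts about amalgamated products.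

    Let the [G i] be groups with a common subgroup [C], and choose in every
    [G i] a transversal of the right cosets of [C]. Van der Waerden's method
    lets the amalgam act on the set of normal forms: a normal form is an
    element of [C] followed by nontrivial representatives, neighbours coming
    from different factors. To let [g] in [G i] act, gather the element of [C]
    and a possible first representative from [G i] into one element of [G i],
    multiply it by [g], and split the result again. This is conjugate to a left
    translation, hence an action, and [C] acts by multiplication on the first
    component in every factor, so the universal property glues these actions.

    An element of [G i] outside [C] sends the trivial normal form to a normal
    form with the single index [i]. Hence no element outside [C] belongs to the
    images of two different factors ([amalgam_inter]). Every element of the
    amalgam is the value of its normal form, so a central [z] outside the image
    of [C] has a nonempty one, ending with some index [j]. Take [g] in a factor
    [G k], [k != j], outside [C]. The word of [z * g] is that of [z] with [k]
    appended, whereas the word of [g * z] is no longer than that of [z] or has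
    an extra first index [k] different from the first index of [z]. So [z] and
    [g] do not commute: the centre lies in the image of [C]
    ([amalgam_center]).

    Two facts about a single Garside monoid remain. First, [G(M_i)] is larger
    than the subgroup generated by [Delta i] ([delta_powers_proper]): as [M_i]
    embeds in its group of fractions ([env_in_inj]), otherwise every element of
    [M_i] would be a power of [Delta i] and [M_i] would be [M(1,1)]. Second,
    some positive power of [Delta i] is central ([delta_central_power]), because
    conjugation by [Delta i] permutes its finitely many divisors. A common
    multiple of these exponents gives a central power of [Delta] in [G(M)], and
    Euclidean division by the least such exponent ends the proof
    ([center_cyclic]). *)

Set Implicit Arguments.
Unset Strict Implicit.
Unset Printing Implicit Defensive.

Import GRing.Theory Num.Theory.
Local Open Scope classical_set_scope.
Local Open Scope group_scope.

(** * Normal forms in amalgamated products *)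

(** The monoid of self-maps under composition: a morphism into it is an action,
    and acting through a monoid avoids building permutation groups of infinite
    sets. *)
Definition selfmap (S : Type) : Type := S -> S.
HB.instance Definition _ (S : Type) := gen_eqMixin (selfmap S).
HB.instance Definition _ (S : Type) := gen_choiceMixin (selfmap S).
HB.instance Definition _ (S : Type) :=
  isMonoid.Build (selfmap S) (mul := fun f g x => f (g x)) (one := id)
    (fun _ _ _ => erefl) (fun _ => erefl) (fun _ => erefl).

Section NormalForms.
Context (I : eqType) (C : groupType) (G : I -> groupType).
Context (iota : forall i, {monoid_hom C -> G i}).
(* Choosing an equivariant retraction [r] onto [C] amounts to choosing a
   transversal of the right cosets of [C] that contains [1]: the representatives
   are the elements that [r] sends to [1]. *)
Context (r : forall i, G i -> C).
Hypothesis r_iota : forall i c (g : G i), r (iota i c * g) = c * r g.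
Hypothesis r1 : forall i, r (1 : G i) = 1.

Local Notation letter := {i : I & G i}.

Definition rep i (g : G i) : G i := (iota i (r g))^-1 * g.

Lemma repE i (g : G i) : iota i (r g) * rep g = g.
Proof. exact: mulVKg. Qed.

Lemma r_rep i (g : G i) : r (rep g) = 1.
Proof. by rewrite /rep -gmulfV r_iota mulVg. Qed.

Lemma rep_iota i c (g : G i) : rep (iota i c * g) = rep g.
Proof. by rewrite /rep r_iota gmulfM invgM -mulgA mulKg. Qed.

Lemma rep_id i (g : G i) : r g = 1 -> rep g = g.
Proof. by rewrite /rep => ->; rewrite gmulf1 invg1 mul1g. Qed.

Definition alternating (js : seq I) := sorted (fun i j => i != j) js.

Definition normal_letter (l : letter) :=
  (r (tagged l) == 1) && (tagged l != 1).

Definition normal_stack (s : seq letter) :=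
  alternating (map tag s) && all normal_letter s.

(** The default value [Tagged G 1] of [tagged_as] is never returned: it only
    fixes the type to which the first letter is cast. *)
Definition pop i (s : seq letter) : G i * seq letter :=
  match s with
  | l :: s' => if tag l == i then (tagged_as (Tagged G (1 : G i)) l, s')
               else (1, s)
  | [::] => (1, [::])
  end.

Definition push i (t : G i) (s : seq letter) :=
  if t == 1 then s else Tagged G t :: s.

Definition fold_head i (x : G i * seq letter) : C * seq letter :=
  (r x.1, push (rep x.1) x.2).

Definition unfold_head i (x : C * seq letter) : G i * seq letter :=
  (iota i x.1 * (pop i x.2).1, (pop i x.2).2).

(** With [unfold_headK], this makes [unfold_head i] a bijection from the normal
    forms to the pairs of an element of [G i] and a normal stack not starting
    with [i]. The action of [G i] is left translation carried through it. *)
Lemma fold_headK i g s : alternating (i :: map tag s) ->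
  unfold_head i (fold_head (g, s)) = (g, s).
Proof.
rewrite /unfold_head /fold_head /push /= => alt_is.
case: eqP => [rep1|_] /=.
  have -> : pop i s = (1, s).
    case: s alt_is => //= l s /andP[il _].
    by rewrite eq_sym (negbTE il).
  by rewrite /= -{2}(repE g) rep1.
by rewrite eqxx /= tagged_asE repE.
Qed.

Lemma normal_pop i s : normal_stack s ->
  [/\ alternating (i :: map tag (pop i s).2), normal_stack (pop i s).2,
      r (pop i s).1 = 1 & push (pop i s).1 (pop i s).2 = s].
Proof.
case: s => [|[j t] s] //=; first by rewrite /push eqxx r1.
rewrite /normal_stack /=.
move=> /andP[alt_js /andP[/andP[/= /eqP rt t1] norm_s]].
have [jis|ji] /= := eqVneq j i.
  subst j; rewrite tagged_asE alt_js norm_s (path_sorted alt_js : alternating _) rt.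
  by rewrite /push (negbTE t1).
rewrite eq_sym ji alt_js norm_s r1 /push eqxx /normal_letter /= rt eqxx.
by rewrite t1.
Qed.

Lemma unfold_headK i c s : normal_stack s ->
  fold_head (unfold_head i (c, s)) = (c, s).
Proof.
move=> /(normal_pop i)[_ _ rt pushE].
by rewrite /fold_head /unfold_head /= r_iota rt mulg1 rep_iota rep_id // pushE.
Qed.

Lemma normal_fold_head i g s : alternating (i :: map tag s) -> normal_stack s ->
  normal_stack (@fold_head i (g, s)).2.
Proof.
rewrite /fold_head /push /= => alt_is; case: eqP => // /eqP rep1 norm_s.
case/andP: norm_s => _ norm_s.
by rewrite /normal_stack /= alt_is norm_s /normal_letter /= r_rep rep1 eqxx.
Qed.

Definition act i (g : G i) (x : C * seq letter) : C * seq letter :=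
  let y := unfold_head i x in fold_head (g * y.1, y.2).

Lemma normal_act i (g : G i) x : normal_stack x.2 -> normal_stack (act g x).2.
Proof. by move=> /(normal_pop i)[? ? _ _]; apply: normal_fold_head. Qed.

Lemma act1 i x : normal_stack x.2 -> act (1 : G i) x = x.
Proof.
by case: x => c s ns; rewrite /act mul1g -surjective_pairing unfold_headK.
Qed.

Lemma actM i (g g' : G i) x : normal_stack x.2 ->
  act (g * g') x = act g (act g' x).
Proof.
move=> /(normal_pop i)[alt_is _ _ _].
by rewrite {2}/act /act fold_headK //= -mulgA.
Qed.

(** All factors induce the same action of [C]: this is what allows gluing. *)
Lemma act_iota i c x : normal_stack x.2 -> act (iota i c) x = (c * x.1, x.2).
Proof.
case: x => c' s /(unfold_headK i c'); rewrite /act; case: (unfold_head i _) => g s'.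
by rewrite /fold_head /= r_iota rep_iota => -[-> ->].
Qed.

(** Here no cancellation can occur, so normal forms grow predictably under
    products of letters from alternating factors. *)
Lemma act_push i (g : G i) c s : (forall c', g != iota i c') ->
  alternating (i :: map tag s) ->
  act g (c, s) = (r (g * iota i c), Tagged G (rep (g * iota i c)) :: s).
Proof.
move=> gNC alt_is; rewrite /act /unfold_head /=.
have -> : pop i s = (1, s).
  by case: s alt_is => //= l s /andP[il _]; rewrite eq_sym (negbTE il).
rewrite mulg1 /fold_head /push ifN //=; apply/eqP => rep1.
move: (gNC (r (g * iota i c) * c^-1)); rewrite gmulfM gmulfV.
by rewrite -{1}(mulgK (iota i c) g) -{1}(repE (g * iota i c)) rep1 mulg1 eqxx.
Qed.

Definition normal_form := {x : C * seq letter | normal_stack x.2}.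

Definition normal_form_act i (g : G i) : selfmap normal_form :=
  fun x => exist _ (act g (val x)) (normal_act g (valP x)).

Lemma normal_form_act_morphism i :
  normal_form_act (1 : G i) = 1
  /\ {morph @normal_form_act i : g g' / g * g'}.
Proof.
split=> [|g g']; apply/funext => x; apply/val_inj => /=.
  by rewrite act1 // (valP x).
by rewrite actM // (valP x).
Qed.

HB.instance Definition _ i := isUMagmaMorphism.Build (G i) (selfmap normal_form)
  (@normal_form_act i) (normal_form_act_morphism i).

(* [E] is the amalgam: the pushout of the maps [iota i], generated by the
   images of the factors. *)
Context (E : groupType) (phi : forall i, {monoid_hom G i -> E}).
Context (delta : C -> E).
Hypothesis phi_iota : forall i c, phi i (iota i c) = delta c.
Hypothesis E_univ :
  forall (P : monoidType) (f : forall i, {monoid_hom G i -> P}),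
  (forall i j c, f i (iota i c) = f j (iota j c)) ->
  exists F : {monoid_hom E -> P}, forall i x, F (phi i x) = f i x.
Hypothesis E_gen : forall Q : E -> Prop, Q 1 ->
  (forall i x g, Q g -> Q (phi i x * g)) -> forall g, Q g.

Definition letters_prod (s : seq letter) : E :=
  foldr (fun l g => phi (tag l) (tagged l) * g) 1 s.

Definition empty_form : normal_form := exist _ (1, [::]) isT.

Lemma amalgam_action : exists F : {monoid_hom E -> selfmap normal_form},
  forall i x, F (phi i x) = normal_form_act x.
Proof.
apply: (E_univ (f := fun i => [the {monoid_hom _ -> _} of @normal_form_act i])).
move=> i j c; apply/funext => x; apply/val_inj => /=.
by rewrite !act_iota // (valP x).
Qed.

Definition eval (x : normal_form) : E :=
  delta (val x).1 * letters_prod (val x).2.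

(** Equivariance of evaluation makes every element of the amalgam the value of
    the normal form to which it sends the trivial one, so normal forms exist. *)
Lemma eval_act i (g : G i) x : eval (normal_form_act g x) = phi i g * eval x.
Proof.
have prod_push (t : G i) s : letters_prod (push t s) = phi i t * letters_prod s.
  by rewrite /push; case: eqP => [->|//]; rewrite gmulf1 mul1g.
rewrite /eval; case: x => [[c s] ns] /=; have [_ _ _ pushE] := normal_pop i ns.
rewrite /fold_head /= prod_push mulgA -(phi_iota i) -gmulfM repE !gmulfM.
by rewrite -!mulgA phi_iota -prod_push pushE.
Qed.

Definition tags (x : normal_form) : seq I := map tag (val x).2.

(** A letter in [C] would be the representative of the coset of [1]. *)
Lemma normal_letter_notin l c : normal_letter l ->
  tagged l != iota (tag l) c.
Proof.
case: l => i t /andP[/= /eqP rt t1]; apply: contra_neq t1 => t_c.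
have c1 : c = 1 by rewrite -rt t_c -[iota i c]mulg1 r_iota r1 mulg1.
by rewrite t_c c1 gmulf1.
Qed.

(** Below a stack that prolongs it alternately, a product of letters adds its
    own indices one by one; letters of [s] may change, but not their indices. *)
Lemma tags_letters_prod (F : {monoid_hom E -> selfmap normal_form}) s x :
  (forall i g, F (phi i g) = normal_form_act g) ->
  all normal_letter s -> alternating (map tag s ++ tags x) ->
  tags (F (letters_prod s) x) = map tag s ++ tags x.
Proof.
move=> FE; elim: s => [|l s IHs] /=; first by rewrite gmulf1.
move=> /andP[norm_l norm_s] alt_ls.
have := IHs norm_s (path_sorted alt_ls).
rewrite gmulfM FE; set y := F (letters_prod s) x => tags_y.
rewrite -[LHS]/(map tag (act (tagged l) (val y)).2) -tags_y.
rewrite -tags_y in alt_ls.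
rewrite [val y in LHS]surjective_pairing act_push //.
by move=> c; apply: normal_letter_notin.
Qed.

Lemma tags_act_empty i x : (forall c, x != iota i c) ->
  tags (normal_form_act x empty_form) = [:: i].
Proof. by move=> xNC; rewrite /tags -[val _]/(act x (1, [::])) act_push. Qed.

(** Left multiplication by an element of one factor merges with the first letter
    or adds a new one, which bounds the normal form of [g * z]. *)
Lemma tags_act i (g : G i) x :
  (size (tags (normal_form_act g x)) <= size (tags x))%N \/
  tags (normal_form_act g x) = i :: tags x /\ alternating (i :: tags x).
Proof.
rewrite /tags -[val (normal_form_act g x)]/(act g (val x)) !size_map.
case: x => [[c [|l s]] ns]; rewrite /act /fold_head /push /=.
  by case: eqP; [left | right].
have [_|li] := eqVneq (tag l) i.
  by left; case: eqP => //= _; apply: leqnSn.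
case: eqP => _; first by left.
by right; split=> //; case/andP: ns.
Qed.

Lemma tags_iota (F : {monoid_hom E -> selfmap normal_form}) i c e x :
  (forall g, F (phi i g) = normal_form_act g) ->
  tags (F (phi i (iota i c) * e) x) = tags (F e x).
Proof.
move=> FE; rewrite gmulfM FE.
rewrite /tags -[val _]/(act (iota i c) (val (F e x))) act_iota //.
exact: (valP (F e x)).
Qed.

(** The indices of the normal form of an element outside [C] remember the factor
    from which it comes. *)
Theorem amalgam_inter i j x y : i != j -> phi i x = phi j y ->
  exists c, x = iota i c.
Proof.
move=> ij phi_xy; apply: contrapT => /forallNP xNC.
have [F FE] := amalgam_action.
have tags_x : tags (normal_form_act x empty_form) = [:: i].
  by apply: tags_act_empty => c; apply/eqP.
have : tags (normal_form_act y empty_form) = [:: i] by rewrite -FE -phi_xy FE.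
case: (pselect (exists c, y = iota j c)) => [[c ->]|/forallNP yNC].
  by rewrite /tags -[val _]/(act (iota j c) (1, [::])) act_iota.
rewrite tags_act_empty => [[ji]|c]; last exact/eqP.
by rewrite ji eqxx in ij.
Qed.

(** If [z] is not in [C], an element [g] outside [C] from a factor other than the
    one of the last letter of [z] does not commute with [z]: the index of [g]
    comes last for [z * g], while for [g * z] it can only come first. *)
Theorem amalgam_center (i0 : I) : (forall i : I, exists j, j != i) ->
  (forall i, exists x : G i, forall c, x != iota i c) ->
  forall z, center E z -> exists c, z = delta c.
Proof.
move=> other proper z z_central.
have [F FE] := amalgam_action.
have zE : eval (F z empty_form) = z.
  elim/E_gen: z {z_central} => [|i x g IHg].
    by rewrite gmulf1 /eval /= mulg1 -(phi_iota i0) !gmulf1.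
  by rewrite gmulfM FE -{2}IHg -eval_act.
have : normal_stack (val (F z empty_form)).2 := valP (F z empty_form).
move: zE; rewrite /eval; case: (val (F z empty_form)) => c s /= zE norm_s.
have tagsF w : alternating (map tag s ++ tags w) ->
    tags (F z w) = map tag s ++ tags w.
  move=> alt_sw; rewrite -{1}zE -(phi_iota i0) tags_iota // tags_letters_prod //.
  by case/andP: norm_s.
have tags_z : tags (F z empty_form) = map tag s.
  by rewrite tagsF cats0 //; case/andP: norm_s.
case: (lastP s) => [|s' l] in zE norm_s tagsF tags_z *.
  by exists c; rewrite -zE mulg1.
have [k kl] := other (tag l); have [g gNC] := proper k.
(* Both normal forms are compared through the two ways of letting [z * g] act
   on the trivial one. *)
have FC w : F z (F (phi k g) w) = F (phi k g) (F z w).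
  by have := congr1 (fun e => F e w) (z_central (phi k g)); rewrite !gmulfM.
have : tags (F (phi k g) (F z empty_form)) = rcons (map tag (rcons s' l)) k.
  rewrite -FC FE tagsF tags_act_empty ?cats1 //.
  case/andP: norm_s; rewrite /alternating map_rcons.
  case: (map tag s') => [|j js] /=; first by rewrite eq_sym kl.
  by rewrite !rcons_path last_rcons [tag l == k]eq_sym kl andbT.
rewrite FE => tags_gz; have := tags_act g (F z empty_form).
rewrite tags_gz tags_z size_rcons ltnn => -[//|[]].
case: s' {tags_gz tags_z tagsF zE norm_s} => [|l' s'] /= [kl'] _.
  by rewrite kl' eqxx in kl.
by rewrite kl' eqxx.
Qed.

End NormalForms.

(** * Universal properties of enveloping groups and of the Delta-product *)

Lemma mquo_extend (N P : monoidType) (R : N -> N -> Prop)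
    (f : {monoid_hom N -> P}) :
  (forall x y, R x y -> f x = f y) ->
  exists F : {monoid_hom mquo R -> P}, forall x, F (mquo_pi R x) = f x.
Proof.
move=> fR; have liftE := mquo_liftE fR.
have lift_hom : mquo_lift f (1 : mquo R) = 1
    /\ {morph mquo_lift f : x y / (x : mquo R) * y >-> x * y}.
  split; first by rewrite liftE gmulf1.
  elim/mquo_ind=> x; elim/mquo_ind=> y.
  by rewrite [_ * _]mquo_mulE !liftE gmulfM.
pose F := HB.pack_for {monoid_hom mquo R -> P} (mquo_lift f : mquo R -> P)
  (isUMagmaMorphism.Build (mquo R) P (mquo_lift f) lift_hom).
by exists F.
Qed.

Lemma free_extend (X : choiceType) (P : monoidType) (f : X -> P) :
  exists F : {monoid_hom free_monoid X -> P},
    F [::] = 1 /\ forall x w, F (x :: w) = f x * F w.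
Proof.
pose g (w : free_monoid X) := foldr (fun x p => f x * p) 1 w.
have g_hom : g 1 = 1 /\ {morph g : u v / u * v}.
  split=> // u v; elim: u => [|x u IHu]; first by rewrite /= !mul1g.
  by rewrite -[LHS]/(f x * g ((u : free_monoid X) * v)) IHu mulgA.
pose F := HB.pack_for {monoid_hom free_monoid X -> P} g
  (isUMagmaMorphism.Build (free_monoid X) P g g_hom).
by exists F.
Qed.

Section EnvelopingGroup.
Context (M : monoidType).

(** The target is only a monoid, so that actions by self-maps are covered. *)
Lemma env_extend (P : monoidType) (f : {monoid_hom M -> P}) :
  (forall a, exists y, f a * y = 1 /\ y * f a = 1) ->
  exists F : {monoid_hom env_group M -> P}, forall a, F (env_in a) = f a.
Proof.
move=> /choice[g gP].
have [W [W0 WS]] := free_extend (fun x : M * bool => if x.2 then g x.1 else f x.1).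
have [|F FE] := @mquo_extend _ _ (@env_rel M) W.
  move=> x y [|a b|a|a]; rewrite !WS !W0 ?mulg1 //= ?gmulf1 ?gmulfM //.
    by have [] := gP a.
  by have [] := gP a.
by exists F => a; rewrite FE WS W0 mulg1.
Qed.

Lemma env_ind (Q : env_group M -> Prop) : Q 1 ->
  (forall a g, Q g -> Q (env_in a * g)) ->
  (forall a g, Q g -> Q ((env_in a)^-1 * g)) -> forall g, Q g.
Proof.
move=> Q1 Qin Qinv; elim/mquo_ind; elim=> [|[a b] w IHw] //.
have inE : mquo_pi (@env_rel M) ((a, b) :: w)
  = mquo_pi (@env_rel M) [:: (a, b)] * mquo_pi (@env_rel M) w.
  by rewrite [RHS]mquo_mulE.
rewrite inE; case: b {inE}; last exact: Qin.
suff <- : (env_in a)^-1 = mquo_pi (@env_rel M) [:: (a, true)] by apply: Qinv.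
apply: mulg1_eq.
rewrite [LHS](mquo_mulE (@env_rel M) [:: (a, false)] [:: (a, true)]).
by apply/mquo_piE/cong_rel; constructor.
Qed.

(** A monoid morphism sends inverses to inverses, and these are unique. *)
Lemma env_hom_eq (P : monoidType) (F F' : {monoid_hom env_group M -> P}) :
  (forall a, F (env_in a) = F' (env_in a)) -> F =1 F'.
Proof.
move=> eqF; elim/env_ind => [|a g IHg|a g IHg]; first by rewrite !gmulf1.
  by rewrite !gmulfM eqF IHg.
rewrite !gmulfM IHg; congr (_ * _).
have VF : F (env_in a)^-1 * F (env_in a) = 1 by rewrite -gmulfM mulVg gmulf1.
have F'V : F' (env_in a) * F' (env_in a)^-1 = 1 by rewrite -gmulfM mulgV gmulf1.
by rewrite -[LHS]mulg1 -F'V mulgA -eqF VF mul1g.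
Qed.

Lemma env_trivial : (forall a : M, a = 1) ->
  forall g : env_group M, g = 1.
Proof.
move=> M1; elim/env_ind => [|a g ->|a g ->] //.
  by rewrite (M1 a) gmulf1 mulg1.
by rewrite (M1 a) gmulf1 invg1 mulg1.
Qed.

End EnvelopingGroup.

Section DeltaProduct.
Context (h : nat) (M : 'I_h -> monoidType) (Delta : forall i, M i).

Lemma delta_extend (P : monoidType) (f : forall i, {monoid_hom M i -> P}) :
  (forall i j, f i (Delta i) = f j (Delta j)) ->
  exists F : {monoid_hom delta_product Delta -> P},
    forall i a, F (delta_in Delta i a) = f i a.
Proof.
move=> fD.
have [W [W0 WS]] := free_extend (fun l : {i : 'I_h & M i} => f (tag l) (tagged l)).
have [|V VE] := @mquo_extend _ _ (@free_product_rel h M) W.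
  by move=> x y [i|i a b]; rewrite !WS !W0 !mulg1 /= ?gmulf1 ?gmulfM.
have inE i a : V (free_product_in (a : M i)) = f i a.
  by rewrite VE WS W0 mulg1.
have [|F FE] := @mquo_extend _ _ (@delta_rel h M Delta) V.
  by move=> x y [i j]; rewrite !inE.
by exists F => i a; rewrite FE inE.
Qed.

Lemma delta_ind (Q : delta_product Delta -> Prop) : Q 1 ->
  (forall i a x, Q x -> Q (delta_in Delta i a * x)) -> forall x, Q x.
Proof.
move=> Q1 Qin; elim/mquo_ind; elim/mquo_ind; elim=> [|[i a] w IHw] //.
have -> : mquo_pi (@free_product_rel h M) (Tagged M a :: w)
  = free_product_in a * mquo_pi (@free_product_rel h M) w.
  by rewrite [RHS]mquo_mulE.
by rewrite gmulfM; apply: Qin.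
Qed.

Lemma delta_product_trivial :
  (forall i (a : M i), a = 1) -> forall x : delta_product Delta, x = 1.
Proof.
by move=> M1; elim/delta_ind => // i a x ->; rewrite (M1 i a) gmulf1 mulg1.
Qed.

Local Notation E := (env_group (delta_product Delta)).

(** Enveloping groups preserve pushouts, being a left adjoint: the enveloping
    group of the Delta-product is the amalgam of the enveloping groups. *)
Lemma env_delta_extend (P : monoidType)
    (f : forall i, {monoid_hom env_group (M i) -> P}) :
  (forall i j, f i (env_in (Delta i)) = f j (env_in (Delta j))) ->
  exists F : {monoid_hom E -> P}, forall i x, F (delta_phi Delta i x) = f i x.
Proof.
move=> fD.
have [] := @delta_extend P
  (fun i => [the {monoid_hom _ -> _} of f i \o @env_in (M i)]).
  exact: fD.
move=> F0 F0E; have [|F FE] := @env_extend _ _ F0.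
  elim/delta_ind => [|i a x [y [xy yx]]].
    by exists 1; rewrite gmulf1 mul1g.
  exists (y * f i (env_in a)^-1); rewrite gmulfM F0E /=; split.
    by rewrite -mulgA [F0 x * _]mulgA xy mul1g -gmulfM mulgV gmulf1.
  by rewrite -mulgA [f i _ * (_ * _)]mulgA -gmulfM mulVg gmulf1 mul1g.
exists F => i.
apply: (env_hom_eq (F := [the {monoid_hom _ -> _} of F \o delta_phi Delta i])) => a.
by rewrite /= /delta_phi env_map_in FE F0E.
Qed.

Lemma env_delta_ind (Q : E -> Prop) : Q 1 ->
  (forall i x g, Q g -> Q (delta_phi Delta i x * g)) -> forall g, Q g.
Proof.
move=> Q1 Qphi.
have Qin x : (forall g, Q g -> Q (env_in x * g))
    /\ (forall g, Q g -> Q ((env_in x)^-1 * g)).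
  elim/delta_ind: x => [|i a x [IHx IHVx]].
    by rewrite gmulf1; split=> g; rewrite ?invg1 mul1g.
  have inM : env_in (delta_in Delta i a * x)
      = delta_phi Delta i (env_in a) * env_in x.
    by rewrite /delta_phi env_map_in; apply: gmulfM.
  rewrite inM; split=> g Qg.
    by rewrite -mulgA; apply/Qphi/IHx.
  by rewrite invgM -mulgA; apply: IHVx; rewrite -gmulfV; apply: Qphi.
by elim/env_ind => [|a|a] //; have [] := Qin a.
Qed.

End DeltaProduct.

(** * Integer powers and cyclic subgroups *)

Local Notation infcyc := (Algebra.to_multiplicative int).

Section IntegerPowers.
Context (G : groupType) (x : G).

Definition zexp (n : infcyc) : G :=
  match (n : int) with Posz m => x ^+ m | Negz m => x ^- m.+1 end.

(** Writing integers as differences avoids a case analysis on signs when proving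
    that [zexp] is a morphism. *)
Lemma zexp_sub (a b : nat) : zexp (a%:Z - b%:Z)%R = x ^+ a / x ^+ b.
Proof.
have [ba|/ltnW ab] := leqP b a; first by rewrite subzn // /zexp expgnFr.
rewrite -opprB subzn // -{2}(subnK ab) expgnDr invgM mulVKg.
case: (b - a)%N => [|c]; first by rewrite invg1.
by rewrite -NegzE.
Qed.

Lemma zexp_hom : zexp 1 = 1 /\ {morph zexp : m n / m * n}.
Proof.
have zdiff (n : infcyc) : exists a b : nat, n = (a%:Z - b%:Z)%R.
  by case: n => n; [exists n, 0%N | exists 0%N, n.+1]; lia.
split=> // m n; have [a [b ->]] := zdiff m; have [c [d ->]] := zdiff n.
have -> : ((a%:Z - b%:Z)%R : infcyc) * (c%:Z - d%:Z)%R
    = ((a + c)%N%:Z - (b + d)%N%:Z)%R.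
  by rewrite /mul /=; lia.
rewrite !zexp_sub expgnDr [(b + d)%N]addnC expgnDr invgM -!mulgA; congr (_ * _).
rewrite !mulgA; congr (_ * _).
exact/commuteV/commuteX2/commute_refl.
Qed.

HB.instance Definition _ := isUMagmaMorphism.Build infcyc G zexp zexp_hom.

End IntegerPowers.

Lemma gmulf_zexp (G H : groupType) (f : {monoid_hom G -> H}) x n :
  f (zexp x n) = zexp (f x) n.
Proof. by case: n => n; rewrite /zexp ?gmulfXVn ?gmulfXn. Qed.

Lemma zexpX (G : groupType) (x : G) k n :
  zexp (x ^+ k) n = zexp x (k%:Z * (n : int))%R.
Proof.
case: n => n; first by rewrite -PoszM /zexp expgnA.
rewrite {1}/zexp NegzE mulrN -PoszM -expgnA.
by case: (k * n.+1)%N => [|m]; [rewrite oppr0 invg1 | rewrite -NegzE].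
Qed.

Lemma length_zexp (G : groupType) (L : {monoid_hom G -> infcyc}) (x : G) n :
  L (zexp x n) = ((n : int) * (L x : int))%R.
Proof.
have LX m : L (x ^+ m) = (m%:Z * (L x : int))%R.
  elim: m => [|m IHm]; first by rewrite gmulf1 mul0r.
  rewrite expgS gmulfM [LHS]/((L x : int) + (L (x ^+ m)%g : int))%R IHm.
  by rewrite intS mulrDl mul1r.
case: n => m; first exact: LX.
by rewrite /zexp gmulfV [LHS]/(- (L (x ^+ m.+1)%g : int))%R LX NegzE mulNr.
Qed.

Lemma is_subgroup_center (G : groupType) : is_subgroup (center G).
Proof.
split=> [y|x y xc yc z|x xc y]; first exact/commute_sym/commute1.
  exact/commute_sym/commuteM/commute_sym/yc/commute_sym/xc.
exact/commute_sym/commuteV/commute_sym/xc.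
Qed.

Lemma is_subgroup_range (G H : groupType) (f : {monoid_hom G -> H}) :
  is_subgroup (range f).
Proof.
split=> [|x y [a _ <-] [b _ <-]|x [a _ <-]]; first by exists 1; rewrite // gmulf1.
  by exists (a * b); rewrite // gmulfM.
by exists a^-1; rewrite // gmulfV.
Qed.

Lemma subgroup_zexp (G : groupType) (S : set G) x n :
  is_subgroup S -> S x -> S (zexp x n).
Proof.
move=> [S1 SM SV] Sx; have SX m : S (x ^+ m).
  by elim: m => // m IHm; rewrite expgS; apply: SM.
by case: n => m; [apply: SX | apply/SV/SX].
Qed.

Lemma gen_subgroup_cycle (G : groupType) (x : G) :
  gen_subgroup [set x] = range (zexp x).
Proof.
rewrite eqEsubset; split=> [|y [n _ <-] S [subS xS]].
  apply: smallest_sub; first exact: is_subgroup_range.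
  by move=> y ->; exists (Posz 1).
by apply: subgroup_zexp => //; apply: xS.
Qed.

(** Central exponents form a subgroup of the integers, generated by its least
    positive element. *)
Lemma center_cyclic (G : groupType) (x : G) K :
  (0 < K)%N -> center G (x ^+ K) ->
  (forall z, center G z -> exists n, z = zexp x n) ->
  exists k : nat, [/\ (0 < k)%N, center G (x ^+ k),
    forall j : nat, (0 < j)%N -> center G (x ^+ j) -> (k <= j)%N
    & center G = gen_subgroup [set x ^+ k]].
Proof.
move=> K0 xK z_power; have [_ cM cV] := is_subgroup_center G.
have exk : exists k, (0 < k)%N && `[< center G (x ^+ k) >].
  by exists K; rewrite K0; apply/asboolP.
case: (ex_minnP exk) => k /andP[k0 /asboolP xk] kmin.
have {}kmin j : (0 < j)%N -> center G (x ^+ j) -> (k <= j)%N.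
  by move=> j0 xj; apply: kmin; rewrite j0; apply/asboolP.
exists k; split=> //; rewrite gen_subgroup_cycle eqEsubset; split; last first.
  by move=> _ [n _ <-]; apply: (subgroup_zexp _ (is_subgroup_center G)).
move=> z zC; have [n zn] := z_power z zC.
exists ((n : int) %/ Posz k)%Z => //; rewrite zn zexpX.
have [r nr rk] : exists2 r : nat, ((n : int) %% Posz k)%Z = r & (r < k)%N.
  exists `|((n : int) %% Posz k)%Z|%N; first by rewrite gez0_abs // modz_ge0; lia.
  have := ltz_pmod (n : int) (_ : 0 < k%:Z)%R.
  by have := modz_ge0 (n : int) (_ : k%:Z != 0)%R; lia.
set q := ((n : int) %/ Posz k)%Z.
have nE : n = ((k%:Z * q)%R : infcyc) * (Posz r : infcyc).
  rewrite -[RHS]/(k%:Z * q + r%:Z)%R -nr mulrC; exact: divz_eq.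
suff r0 : r = 0%N by rewrite [in RHS]nE r0 gmulfM mulg1.
apply/eqP; rewrite -leqn0 leqNgt; apply/negP => r_gt0.
have := kmin r r_gt0; suff xr : center G (x ^+ r) by move=> /(_ xr); lia.
have -> : x ^+ r = (zexp (x ^+ k) q)^-1 * z.
  by rewrite zn [in RHS]nE gmulfM zexpX mulKg.
by apply: cM => //; apply: cV; apply: (subgroup_zexp _ (is_subgroup_center G)).
Qed.

(** * Homogeneous Garside monoids and their enveloping groups *)

Lemma gen_submonoid_sub (N : monoidType) (A B : set N) :
  gen_submonoid A = [set: N] -> is_submonoid B -> (forall x, A x -> B x) ->
  forall x, B x.
Proof.
move=> genA subB AB x; have : gen_submonoid A x by rewrite genA.
by apply.
Qed.

Section GarsideMonoid.
Context (M : monoidType) (Delta : M).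

Section Length.
Context (len : {monoid_hom M -> addnat}).
Hypothesis len_gen : gen_submonoid [set x | (0 < (len x : nat))%N] = [set: M].

Lemma lenM x y : len (x * y) = (len x + len y)%N :> nat.
Proof. by rewrite gmulfM. Qed.

(** The identity and the elements of positive length form a submonoid that
    contains the generators. *)
Lemma len_eq0 x : len x = 0%N :> nat -> x = 1.
Proof.
suff [//|] : x = 1 \/ (0 < (len x : nat))%N by lia.
apply: (gen_submonoid_sub (B := fun x => x = 1 \/ (0 < (len x : nat))%N) len_gen).
  split; first by left.
  move=> {}x y [->|lx]; first by rewrite mul1g.
  by move=> _; right; rewrite lenM; lia.
by move=> {}x lx; right.
Qed.

Lemma env_length : exists L : {monoid_hom env_group M -> infcyc},
  forall a, L (env_in a) = Posz (len a).
Proof.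
have hom : ((Posz (len 1) : infcyc) = 1) /\
    {morph (fun a => (Posz (len a) : infcyc)) : a b / a * b}.
  split=> [|a b]; first by rewrite gmulf1.
  by rewrite lenM PoszD.
pose f := HB.pack_for {monoid_hom M -> infcyc} (fun a => (Posz (len a) : infcyc))
  (isUMagmaMorphism.Build M infcyc _ hom).
have [|L LE] := @env_extend _ _ f; last by exists L.
by move=> a; exists (f a)^-1; rewrite mulgV mulVg.
Qed.

Lemma len_gt0 (x : M) : x <> 1 -> (0 < (len x : nat))%N.
Proof.
move=> x1; rewrite lt0n; apply/eqP => l0; apply: x1.
exact: len_eq0.
Qed.

End Length.

Hypothesis garside : homogeneous_garside Delta.

(** The divisors of [1] have length [0], so they are [1], and they generate. *)
Lemma delta1_trivial : Delta = 1 -> forall x : M, x = 1.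
Proof.
case: garside => -[[len len_gen] _] [_ _ _ _ gen] D1.
apply: (gen_submonoid_sub (B := [set 1]) gen).
  by split=> // x y -> ->; rewrite mul1g.
move=> x [c xc]; apply: (len_eq0 len_gen).
have : (len (x * c) : nat) = 0%N by rewrite -xc D1 gmulf1.
by rewrite lenM => /eqP; rewrite addn_eq0 => /andP[/eqP].
Qed.

Lemma cancelR (a x y : M) : x * a = y * a -> x = y.
Proof. by case: garside => -[_ /(_ a x y)[]]. Qed.

(** If [Delta = s * t], then the right divisor [t] is also a left divisor, say
    [Delta = t * s'], and [s * Delta = s * t * s' = Delta * s']. *)
Lemma delta_conj : exists sigma : M -> M, forall s, ldiv s Delta ->
  ldiv (sigma s) Delta /\ s * Delta = Delta * sigma s.
Proof.
case: garside => _ [_ _ lr _ _].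
suff /choice[sigma sigmaP] : forall s, exists s', ldiv s Delta ->
  ldiv s' Delta /\ s * Delta = Delta * s' by exists sigma.
move=> s; case: (pselect (ldiv s Delta)) => [|ns]; last by exists 1.
have rl t : rdiv t Delta -> ldiv t Delta.
  by move: (congr1 (fun A : set M => A t) lr) => /= ->.
case=> t st; have /rl[s' ts'] : rdiv t Delta by exists s.
exists s' => _; split; last by rewrite {1}ts' mulgA -st.
by apply: rl; exists t.
Qed.

(** Conjugation by [Delta] is an injection of the finite set of divisors into
    itself, hence a permutation; raised to the factorial of the number of
    divisors it is the identity, and the divisors generate. *)
Lemma delta_central_power : exists k, (0 < k)%N /\
  forall x : M, commute x (Delta ^+ k).
Proof.
have [sigma sigmaP] := delta_conj.
case: garside => _ [_ _ _ fin gen].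
have /finite_seqP[ss ssE] := fin.
have ssP x : ldiv x Delta <-> x \in ss.
  by have /= -> := congr1 (fun A : set M => A x) ssE.
have sigma_ss (u : seq_sub ss) : sigma (val u) \in ss.
  by apply/ssP; apply: (sigmaP _ _).1; apply/ssP/valP.
pose f (u : seq_sub ss) : seq_sub ss := SeqSub (sigma_ss u).
have f_inj : injective f.
  move=> u v /(congr1 val)/= uv; apply/val_inj/(@cancelR Delta).
  rewrite (sigmaP _ ((ssP _).2 (valP u))).2 (sigmaP _ ((ssP _).2 (valP v))).2.
  by rewrite uv.
have shift n (u : seq_sub ss) :
    val u * Delta ^+ n = Delta ^+ n * val (iter n f u).
  elim: n => [|n IHn] /=; first by rewrite expg0 mulg1 mul1g.
  rewrite expgSr mulgA IHn -mulgA.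
  by rewrite (sigmaP _ ((ssP _).2 (valP (iter n f u)))).2 mulgA.
exists (#|{: seq_sub ss}|)`!; split; first exact: fact_gt0.
apply: (gen_submonoid_sub gen) => [|x /ssP x_ss].
  split=> [|x y cx cy]; first exact/commute_sym/commute1.
  exact/commute_sym/commuteM/commute_sym.
rewrite /commute (shift _ (SeqSub x_ss)).
have /dvdnP[q ->] : (order f (SeqSub x_ss) %| (#|{: seq_sub ss}|)`!)%N.
  by rewrite dvdn_fact // order_gt0 max_card.
rewrite iterM.
have -> // : iter q (iter (order f (SeqSub x_ss)) f) (SeqSub x_ss) = SeqSub x_ss.
by elim: q => //= q ->; rewrite iter_order.
Qed.

(** The elements that divide some power of a central power of [Delta] form a
    submonoid containing the divisors of [Delta]; so the enveloping group is
    obtained by inverting one central element. *)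
Lemma divides_delta_power k : (0 < k)%N -> (forall x : M, commute x (Delta ^+ k)) ->
  forall a : M, exists y n, a * y = (Delta ^+ k) ^+ n /\ y * a = (Delta ^+ k) ^+ n.
Proof.
move=> k0 zC a; set z := Delta ^+ k in zC *.
have znC n x : commute x (z ^+ n) by apply: commuteX.
suff [y [n ayz]] : exists y n, a * y = z ^+ n.
  exists y, n; split=> //; apply: (@cancelR y).
  by rewrite -mulgA ayz; apply: znC.
case: garside => _ [_ _ _ _ gen].
move: a; apply: (gen_submonoid_sub gen) => [|a [c ac]].
  split=> [|a b [y [n ay]] [y' [n' by']]]; first by exists 1, 0%N; rewrite mulg1.
  exists (y' * y), (n' + n)%N.
  by rewrite -mulgA [b * _]mulgA by' -znC mulgA ay znC expgnDr.
by exists (c * Delta ^+ k.-1), 1%N; rewrite mulgA -ac -expgS prednK.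
Qed.

(** Every element is invertible in the localization of [M] at the central
    cancellable [z = Delta ^+ k]. Words in the enveloping group are evaluated
    there, as fractions [m / z ^+ n]; congruent words have equal fractions, and
    fractions with denominator [1] are equal only if their numerators are. *)
Lemma env_in_inj : injective (@env_in M).
Proof.
have [k [k0 zC]] := delta_central_power.
have [inv invP] := choice (divides_delta_power k0 zC).
have [e {}invP] := choice invP.
set z := Delta ^+ k in zC invP.
have znC n x : commute x (z ^+ n) by apply: commuteX.
(* [frac w] is the pair (numerator, exponent of the denominator) of the word
   [w]; the inverse of [a] is [inv a / z ^+ e a]. *)
pose step (l : M * bool) (x : M * nat) :=
  if l.2 then (inv l.1 * x.1, (e l.1 + x.2)%N) else (l.1 * x.1, x.2).
pose frac (w : free_monoid (M * bool)%type) : M * nat := foldr step (1, 0%N) w.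
pose eqf (x y : M * nat) := x.1 * z ^+ y.2 = y.1 * z ^+ x.2.
have fracM u v : frac (u * v)
    = ((frac u).1 * (frac v).1, ((frac u).2 + (frac v).2)%N).
  elim: u => [|l u IHu].
    rewrite -[LHS]/(frac v) /=.
    by case: (frac v) => x n; rewrite /= mul1g.
  rewrite -[frac _]/(step l (frac ((u : free_monoid _) * v))) IHu.
  rewrite -[frac (l :: u)]/(step l (frac u)) /step.
  by case: l.2; rewrite /= mulgA ?addnA.
have cong_frac u v : cong (@env_rel M) u v -> eqf (frac u) (frac v).
  elim=> {u v} [u v []|//|//|v u w _ uv _ vw|u u' v v' _ uu' _ vv'].
  - by rewrite /eqf /= !mulg1.
  - by move=> a b; rewrite /eqf /= !mulg1.
  - by move=> a; rewrite /eqf /= !mulg1 addn0 mul1g (invP a).1.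
  - by move=> a; rewrite /eqf /= !mulg1 addn0 mul1g (invP a).2.
  - apply: (@cancelR (z ^+ (frac v).2)).
    by rewrite -mulgA znC mulgA uv -mulgA znC mulgA vw -!mulgA znC.
  - rewrite /eqf !fracM /= !expgnDr.
    set m := (frac u).1; set n := (frac v).1.
    rewrite (znC (frac v').2 (z ^+ (frac u').2)) mulgA -[m * n * _]mulgA vv'.
    rewrite -mulgA (znC (frac u').2 ((frac v').1 * _)) mulgA uu' -!mulgA.
    congr (_ * _).
    by rewrite [LHS]mulgA -(znC _ (frac v').1) -mulgA.
move=> a b /mquo_piE/cong_frac.
by rewrite /eqf /= !mulg1.
Qed.

(** As [Delta] has positive length, division of the length by that of [Delta]
    gives an equivariant map onto the powers of [Delta]. *)
Lemma delta_retraction : Delta <> 1 -> exists r : env_group M -> infcyc,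
  (forall n g, r (zexp (env_in Delta) n * g) = n * r g) /\ r 1 = 1.
Proof.
case: garside => -[[len len_gen] _] _ D1.
have lD := len_gt0 len_gen D1.
have [L LE] := env_length len.
exists (fun g => ((L g : int) %/ Posz (len Delta))%Z); split=> [n g|].
  rewrite gmulfM.
  rewrite -[(L _ * L g)]/((L (zexp (env_in Delta) n) : int) + (L g : int))%R.
  rewrite length_zexp LE.
  rewrite divzMDl //; lia.
by rewrite gmulf1 div0z.
Qed.

(** If every element of the enveloping group were a power of [Delta], those of
    [M], having nonnegative length, would be powers of [Delta] in [M] itself, with
    exponents given by an isomorphism onto [M(1,1)]. *)
Lemma delta_powers_proper : Delta <> 1 -> ~ is_M11 Delta ->
  exists g : env_group M, forall n, g != zexp (env_in Delta) n.
Proof.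
case: garside => -[[len len_gen] _] _ D1 notM11.
have lD := len_gt0 len_gen D1.
have [L LE] := env_length len.
apply: contrapT => /forallNP all_powers; apply: notM11.
have powerP (a : M) : exists n : nat, a = Delta ^+ n.
  have /existsNP[n /negP/negPn/eqP a_n] := all_powers (env_in a).
  have := congr1 L a_n; rewrite length_zexp !LE => la.
  have n0 : (0 <= (n : int))%R by nia.
  case: n n0 a_n {la} => // m _ a_m; exists m.
  by apply: env_in_inj; rewrite a_m gmulfXn.
have [f fP] := choice powerP.
have lenX n : len (Delta ^+ n) = (n * len Delta)%N :> nat.
  elim: n => [|n IHn]; first by rewrite gmulf1.
  by rewrite expgS lenM IHn mulSn.
have powK n : f (Delta ^+ n) = n.
  have := congr1 (fun x => len x : nat) (fP (Delta ^+ n)).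
  by rewrite !lenX => /eqP; rewrite eqn_pmul2r // => /eqP.
have f_hom : (f 1 : addnat) = 1 /\ {morph (f : M -> addnat) : a b / a * b}.
  split; first exact: (powK 0%N).
  by move=> a b; rewrite {1}(fP a) {1}(fP b) -expgnDr powK.
pose F := HB.pack_for {monoid_hom M -> addnat} (f : M -> addnat)
  (isUMagmaMorphism.Build M addnat f f_hom).
exists F; last exact: (powK 1%N).
by exists (fun n => Delta ^+ n) => [a|n]; rewrite /F /= ?powK // -fP.
Qed.

Lemma env_delta_central_power : exists k, (0 < k)%N /\
  forall g, commute g (env_in Delta ^+ k).
Proof.
have [k [k0 zC]] := delta_central_power; exists k; split=> //.
have inC a : commute (env_in a) (env_in Delta ^+ k).
  by rewrite -gmulfXn; apply: gmulf_commute.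
elim/env_ind => [|a g IHg|a g IHg]; first exact/commute_sym/commute1.
  exact/commute_sym/commuteM/commute_sym/IHg/commute_sym/inC.
apply/commute_sym/commuteM/commute_sym/IHg.
exact/commuteV/commute_sym.
Qed.

End GarsideMonoid.

(** * The Delta-product *)

(** The product of the exponents found in the factors is a common multiple. *)
Lemma delta_product_central_power (h : nat) (M : 'I_h -> monoidType)
    (Delta : forall i, M i) (D : delta_product Delta) :
  (forall i, homogeneous_garside (Delta i)) ->
  (forall i, D = delta_in Delta i (Delta i)) ->
  exists k, (0 < k)%N /\ center (env_group (delta_product Delta)) (env_in D ^+ k).
Proof.
move=> garside D_def.
have [k kP] := choice (fun i => env_delta_central_power (garside i)).
exists (\prod_i k i)%N; split.
  by apply: prodn_gt0 => i; have [] := kP i.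
have phi_comm i x : commute (delta_phi Delta i x) (env_in D ^+ (\prod_i k i)%N).
  rewrite (bigD1 i) //= expgnA; apply: commuteX.
  have -> : env_in D ^+ k i = delta_phi Delta i (env_in (Delta i) ^+ k i).
    have <- : delta_phi Delta i (env_in (Delta i)) = env_in D.
      by rewrite (D_def i); apply: env_map_in.
    by rewrite gmulfXn.
  by apply: gmulf_commute; have [_] := kP i.
move=> y; apply: commute_sym; move: y.
elim/env_delta_ind => [|i x g IHg]; first exact/commute_sym/commute1.
exact/commute_sym/commuteM/commute_sym/IHg/commute_sym/phi_comm.
Qed.

Theorem proposition3p12 (h : nat) (h_ge2 : (2 <= h)%N)
    (M : 'I_h -> monoidType) (Delta : forall i : 'I_h, M i)
    (garside : forall i, homogeneous_garside (Delta i))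
    (not_M11 : forall i, ~ is_M11 (Delta i))
    (not_mixed : forall i j, Delta i = 1 -> Delta j = 1)
    (D : delta_product Delta)
    (D_def : forall i, D = delta_in Delta i (Delta i)) :
  \bigcap_(i in [set: 'I_h]) range (delta_phi Delta i)
    = gen_subgroup [set env_in D]
  /\ exists k : nat,
     [/\ (0 < k)%N,
         center (env_group (delta_product Delta)) (env_in D ^+ k),
         forall j : nat, (0 < j)%N ->
           center (env_group (delta_product Delta)) (env_in D ^+ j) ->
           (k <= j)%N
       & center (env_group (delta_product Delta))
           = gen_subgroup [set env_in D ^+ k]].
Proof.
set E := env_group (delta_product Delta).
have [K [K0 DK]] := delta_product_central_power garside D_def.
pose i0 : 'I_h := Ordinal (ltnW h_ge2); pose i1 : 'I_h := Ordinal h_ge2.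
have DE i : delta_phi Delta i (env_in (Delta i)) = env_in D.
  by rewrite (D_def i); apply: env_map_in.
pose iota i :=
  [the {monoid_hom infcyc -> env_group (M i)} of zexp (env_in (Delta i))].
pose phi i := [the {monoid_hom env_group (M i) -> E} of delta_phi Delta i].
have phi_iota i n : phi i (iota i n) = zexp (env_in D) n.
  by rewrite -(DE i); apply: (gmulf_zexp (phi i)).
suff [inter_sub center_sub] :
    (forall x, (\bigcap_(i in [set: 'I_h]) range (delta_phi Delta i)) x ->
       exists n, x = zexp (env_in D) n)
    /\ (forall z : E, center E z -> exists n, z = zexp (env_in D) n).
  split; last exact: center_cyclic K0 DK center_sub.
  rewrite gen_subgroup_cycle eqEsubset; split=> [x /inter_sub[n ->]|].
    by exists n.
  by move=> _ [n _ <-] i _; exists (iota i n) => //; apply: phi_iota.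
case: (pselect (Delta i0 = 1)) => [D1|Dneq1].
  have E1 (g : E) : g = 1.
    apply: env_trivial => x; apply: delta_product_trivial => {x} i.
    exact: (delta1_trivial (garside i) (not_mixed _ _ D1)).
  by split=> x _; exists 1; rewrite (E1 x) gmulf1.
have {}Dneq1 i : Delta i <> 1 by move=> /(not_mixed i i0).
pose r i := sval (cid (delta_retraction (garside i) (Dneq1 i))).
have rP i := svalP (cid (delta_retraction (garside i) (Dneq1 i))).
(* Agreement on all of the cyclic group includes agreement on its generator. *)
have E_univ (P : monoidType) (f : forall i, {monoid_hom env_group (M i) -> P}) :
    (forall i j n, f i (iota i n) = f j (iota j n)) ->
    exists F : {monoid_hom E -> P}, forall i x, F (phi i x) = f i x.
  by move=> fP; apply: env_delta_extend => i j; apply: (fP i j (Posz 1)).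
split.
  move=> x inter_x; have [[a _ ax] [b _ bx]] := (inter_x i0 I, inter_x i1 I).
  have [n an] := amalgam_inter (fun i => (rP i).1) (fun i => (rP i).2)
    E_univ (isT : i0 != i1) (etrans ax (esym bx)).
  by exists n; rewrite -ax an; apply: phi_iota.
apply: (amalgam_center (fun i => (rP i).1) (fun i => (rP i).2) phi_iota E_univ).
- exact: env_delta_ind.
- exact: i0.
- move=> i; have [->|ii0] := eqVneq i i0; first by exists i1.
  by exists i0; rewrite eq_sym.
- by move=> i; apply: (delta_powers_proper (garside i) (Dneq1 i) (not_M11 i)).
Qed.
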